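(* For all positive integers $j, k, r$, the ordinary generating function $$\sum_{n\ge 0} \operatorname{NCN}_{j,k}(n,r)\, x^n$$ of $j$-noncrossing, $k$-nonnesting, $r$-coloured permutations according to size $n$ is a rational function of $x$. Here $\operatorname{NCN}_{j,k}(n,r)$ is the number of $r$-coloured permutations $\Sigma$ of $[n]$ with $\operatorname{cr}(\Sigma)<j$ and $\operatorname{ne}(\Sigma)<k$.
   Context: Write $[n]=\{1,\dots,n\}$. A permutation $S$ of $[n]$ is a bijection $\sigma:[n]\to[n]$. Arc diagram: $S$ is drawn on vertices $1,\dots,n$ placed in order on a horizontal line, with exactly one arc for each $i\in[n]$, joining $i$ and $\sigma(i)$. The arc is an upper arc if $\sigma(i)\ge i$ (so a fixed point gives an upper loop) and a lower arc if $\sigma(i)<i$. Record each arc as a pair (left endpoint, right endpoint): an upper arc is the pair $(i,\sigma(i))$ with $i\le\sigma(i)$, and a lower arc is the pair $(\sigma(i),i)$ with $\sigma(i)<i$. Let $\operatorname{Arc}(S)$ be the set of all $n$ arcs (upper and lower arcs are regarded as distinct even if they have the same endpoints). $r$-coloured permutation: a pair $\Sigma=(S,\phi)$, where $S$ is a permutation of $[n]$ and $\phi:\operatorname{Arc}(S)\to[r]$ is an arbitrary map (arc colouring). Crossings and nestings: a set of $k$ arcs $(i_1,j_1),\dots,(i_k,j_k)$ is - a $k$-crossing if $i_1<i_2<\dots<i_k<j_1<j_2<\dots<j_k$; - a $k$-nesting if $i_1<i_2<\dots<i_k<j_k<j_{k-1}<\dots<j_1$; - an enhanced $k$-crossing if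 $i_1<i_2<\dots<i_k\le j_1<j_2<\dots<j_k$; - an enhanced $k$-nesting if $i_1<i_2<\dots<i_k\le j_k<j_{k-1}<\dots<j_1$. For permutations, the enhanced notions are used for upper arcs and the non-enhanced notions for lower arcs. Thus $\Sigma$ is said to have a $k$-crossing (resp. $k$-nesting) if there are $k$ upper arcs all of the same colour forming an enhanced $k$-crossing (resp. enhanced $k$-nesting), or $k$ lower arcs all of the same colour forming a $k$-crossing (resp. $k$-nesting). Define $\operatorname{cr}(\Sigma)$ (resp. $\operatorname{ne}(\Sigma)$) as the maximum integer $k$ such that $\Sigma$ has a $k$-crossing (resp. $k$-nesting). $\Sigma$ is $j$-noncrossing if $\operatorname{cr}(\Sigma)<j$ and $k$-nonnesting if $\operatorname{ne}(\Sigma)<k$. Convention for $n=0$: there is exactly one (empty) $r$-coloured permutation, with $\operatorname{cr}=\operatorname{ne}=0$, so $\operatorname{NCN}_{j,k}(0,r)=1$. Rational function means that the formal power series equals a quotient $P(x)/Q(x)$ of two polynomials with rational coefficients, with $Q(0)\neq 0$. *)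

(* Defs.v *)
From HB Require Import structures.
From mathcomp Require Import all_boot all_order all_fingroup all_algebra.

Set Implicit Arguments.
Unset Strict Implicit.
Unset Printing Implicit Defensive.

Import GRing.Theory.

(* The vertices 1, ..., n are represented by the ordinals 0, ..., n - 1.      *)

(* The arc (true, (i, j)) is the upper arc with left endpoint i and right     *)
(* endpoint j; (false, (i, j)) is the lower arc with the same endpoints.      *)
Definition arc (n : nat) : finType := (bool * ('I_n * 'I_n))%type.

Definition is_upper n (a : arc n) : bool := a.1.
Definition left_end n (a : arc n) : nat := a.2.1.
Definition right_end n (a : arc n) : nat := a.2.2.

Definition arc_at n (s : 'S_n) (i : 'I_n) : arc n :=
  if i <= s i then (true, (i, s i)) else (false, (s i, i)).

Definition Arc n (s : 'S_n) : {set arc n} := [set arc_at s i | i : 'I_n].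

Definition arc_of n (s : 'S_n) : finType := {a : arc n | a \in Arc s}.

Definition coloured_perm (n r : nat) : finType :=
  {s : 'S_n & {ffun arc_of s -> 'I_r}}.

(* For t = (i_1, j_1), ..., (i_k, j_k), the chain                             *)
(*   i_1 < ... < i_k [e] j_1 < ... < j_k,                                     *)
(* where e is ltn for crossings and leq for enhanced crossings.               *)
Definition crossing_chain n (e : rel nat) (t : seq (arc n)) : bool :=
  if t is a :: t' then
    [&& path ltn (left_end a) (map (@left_end n) t'),
        e (last (left_end a) (map (@left_end n) t')) (right_end a)
      & path ltn (right_end a) (map (@right_end n) t')]
  else true.

(* Same for i_1 < ... < i_k [e] j_k < ... < j_1.                              *)
Definition nesting_chain n (e : rel nat) (t : seq (arc n)) : bool :=
  if t is a :: t' then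
    [&& path ltn (left_end a) (map (@left_end n) t'),
        e (last (left_end a) (map (@left_end n) t'))
          (last (right_end a) (map (@right_end n) t'))
      & path gtn (right_end a) (map (@right_end n) t')]
  else true.

(* k arcs of one colour, either all upper and satisfying [chain leq], or all  *)
(* lower and satisfying [chain ltn]. The tuple lists the set of arcs in       *)
(* increasing order of left endpoints.                                        *)
Definition has_chain n r (chain : rel nat -> seq (arc n) -> bool)
    (S : coloured_perm n r) (k : nat) : bool :=
  [exists t : k.-tuple (arc_of (tag S)), exists c : 'I_r,
    all (fun a => tagged S a == c) t &&
    (all (fun a => is_upper (val a)) t && chain leq (map val t)
     || all (fun a => ~~ is_upper (val a)) t && chain ltn (map val t))].

Definition has_crossing n r (S : coloured_perm n r) (k : nat) : bool :=
  has_chain (@crossing_chain n) S k.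

Definition has_nesting n r (S : coloured_perm n r) (k : nat) : bool :=
  has_chain (@nesting_chain n) S k.

(* Only k <= n need be considered: see has_crossing_leq and has_nesting_leq.  *)
Definition cr n r (S : coloured_perm n r) : nat :=
  \max_(k < n.+1 | has_crossing S k) k.

Definition ne n r (S : coloured_perm n r) : nat :=
  \max_(k < n.+1 | has_nesting S k) k.

Definition NCN (j k n r : nat) : nat :=
  #|[set S : coloured_perm n r | (cr S < j) && (ne S < k)]|.

Local Open Scope ring_scope.

(* A formal power series over rat is given by its coefficient sequence.       *)
Definition fps_mul (f g : nat -> rat) (n : nat) : rat :=
  \sum_(i < n.+1) f i * g (n - i)%N.

Definition fps_of_poly (P : {poly rat}) (n : nat) : rat := P`_n.

(* f = P / Q, i.e. Q * f = P, where Q is invertible since Q(0) != 0.          *)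
Definition rational_fps (f : nat -> rat) : Prop :=
  exists P Q : {poly rat},
    Q.[0] != 0 /\ fps_mul (fps_of_poly Q) f =1 fps_of_poly P.

Local Close Scope ring_scope.

Lemma has_chain_leq n r (chain : rel nat -> seq (arc n) -> bool)
    (S : coloured_perm n r) (k : nat) :
  (forall e t, chain e t -> sorted ltn (map (@left_end n) t)) ->
  has_chain chain S k -> k <= n.
Proof.
move=> chainP /existsP[t /existsP[c /andP[_ ch]]].
have {ch}[e /chainP lt_t] : exists e, chain e (map val t).
  by case/orP: ch => /andP[_ ch]; [exists leq | exists ltn].
have /card_uniqP card_t : uniq t.
  exact/map_uniq/map_uniq/(sorted_uniq ltn_trans ltnn lt_t).
rewrite -(size_tuple t) -card_t (leq_trans (max_card _)) //.
by rewrite card_sig (leq_trans (leq_imset_card _ _)) // card_ord.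
Qed.

Lemma has_crossing_leq n r (S : coloured_perm n r) (k : nat) :
  has_crossing S k -> k <= n.
Proof. by apply: has_chain_leq => e [|a t] //= /and3P[]. Qed.

Lemma has_nesting_leq n r (S : coloured_perm n r) (k : nat) :
  has_nesting S k -> k <= n.
Proof. by apply: has_chain_leq => e [|a t] //= /and3P[]. Qed.

(* Main.v *)
Require Import Defs.
From mathcomp Require Import all_boot all_order all_fingroup all_algebra.
From mathcomp Require Import boolp zify.

(** Cut a coloured permutation of size a + b between its first a and its last
    b vertices. The arcs that cross the cut are, for each of the two types
    (upper and lower), matched to half-arcs on either side; the only
    information that the two sides share is the interface: for each type, the
    list of the crossing arcs in the order of their right endpoints, with
    their colours and with the relative order of their left endpoints. Two
    facts make the interface useful.

    It takes finitely many values. The arcs of one type that cross the cut are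
    pairwise overlapping, so any two of them with the same colour form a
    2-crossing or a 2-nesting, and an argument of Erdos and Szekeres
    (erdos_szekeres, crossing_bounded) bounds their number in terms of j, k
    and r only.

    It controls gluing. If x and y have the same interface, the left side of x
    and the right side of y fit together into one coloured permutation
    (glue_bij), and this permutation is again j-noncrossing and k-nonnesting
    (glue_chains_below). The reason is that in a k-crossing or k-nesting every
    left endpoint weakly precedes every right endpoint. Hence either all left
    endpoints lie before the cut, and then a copy of the configuration sits in
    x, or all right endpoints lie after it, and a copy sits in y.

    Thus, with s ranging over the interfaces, the number of objects of size
    a + b is the sum over s of L a s * R b s, where L counts left sides and R
    counts right sides (glue_exists, keys_inj, gluing_factorization): the
    Hankel matrix of the counting sequence has finite rank. A linear
    dependency between the vectors L 0, L 1, ... is a linear recurrence for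
    the sequence, which is therefore the coefficient sequence of a rational
    function (rational_fps_of_factorization). *)

Set Implicit Arguments.
Unset Strict Implicit.
Unset Printing Implicit Defensive.

Import GRing.Theory.

(** * Linear recurrences and rational series *)

Section Recurrence.
Local Open Scope ring_scope.

(** The denominator is the reciprocal of the characteristic polynomial p: the
    recurrence says that the product has no coefficient of degree at least
    (size p).-1. *)
Lemma rational_fps_rec (f : nat -> rat) (p : {poly rat}) :
  p != 0 -> (forall b, \sum_(i < size p) p`_i * f (b + i)%N = 0) ->
  rational_fps f.
Proof.
move=> p0 rec; pose Q := Poly (rev p).
have sp : (0 < size p)%N by rewrite size_poly_gt0.
have QE i : (i < size p)%N -> Q`_i = p`_((size p).-1 - i).
  by move=> ip; rewrite coef_Poly nth_rev // -subn1 -subnDA add1n.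
exists (\poly_(i < (size p).-1) fps_mul (fps_of_poly Q) f i), Q.
split; first by rewrite horner_coef0 QE // subn0 lead_coef_eq0.
move=> n; rewrite /fps_of_poly coef_poly; case: ltnP => // le_n.
pose d := (size p).-1; have dE : size p = d.+1 by rewrite prednK.
rewrite -[RHS](rec (n - d)%N) dE /fps_mul.
have dn : (d.+1 <= n.+1)%N by rewrite ltnS.
rewrite (big_ord_widen _ (fun i => p`_i * f (n - d + i)%N) dn).
rewrite (bigID (fun i : 'I_n.+1 => (i < d.+1)%N)) /=.
rewrite [X in _ + X]big1 ?addr0; last first.
  move=> i; rewrite -leqNgt => di.
  by rewrite [Q`_i]nth_default ?mul0r // (leq_trans (size_Poly _)) // size_rev dE.
rewrite -(big_ord_widen _ (fun i => Q`_i * f (n - i)%N) dn).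
rewrite -(big_ord_widen _ (fun i => p`_i * f (n - d + i)%N) dn).
rewrite (reindex_inj rev_ord_inj); apply: eq_bigr => -[i id] _ /=.
rewrite -/d in le_n; rewrite QE ?dE /=; last by rewrite subSS ltnS leq_subr.
rewrite subSS subKn //; congr (_ * f _).
by rewrite subnBA // addnBAC.
Qed.

(** There are #|St|.+1 vectors L a in a space of dimension #|St|; the
    coefficients of a linear dependency between them annihilate the sequence,
    whatever b is. *)
Lemma rational_fps_of_factorization (St : finType) (f : nat -> nat)
    (L : 'I_#|St|.+1 -> St -> nat) (R : nat -> St -> nat) :
  (forall (a : 'I__) b, f (a + b)%N = (\sum_s L a s * R b s)%N) ->
  rational_fps (fun n => (f n)%:R).
Proof.
move=> fLR.
pose A := \matrix_(i < #|St|.+1, s < #|St|) (L i (enum_val s))%:R : 'M[rat]__.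
have kA : kermx A != 0.
  rewrite -mxrank_eq0 mxrank_ker -lt0n subn_gt0 ltnS.
  exact: rank_leq_col.
have /rowV0Pn[c0] := kA.
move/sub_kermxP => cA nz.
pose p := \poly_(i < #|St|.+1) c0 0 (inord i).
have pE (j : 'I_#|St|.+1) : p`_j = c0 0 j.
  by rewrite coef_poly ltn_ord inord_val.
apply: (@rational_fps_rec _ p).
  apply: contraNneq nz => p0; apply/eqP/rowP => j.
  by rewrite -pE p0 coef0 mxE.
move=> b; have sz := size_poly #|St|.+1 (fun i => c0 0 (inord i)).
transitivity (\sum_(i < #|St|.+1) p`_i * (f (b + i)%N)%:R).
  rewrite (big_ord_widen _ (fun i => p`_i * (f (b + i)%N)%:R) sz).
  rewrite big_mkcond; apply: eq_bigr => j _; case: ltnP => // le_p.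
  by rewrite nth_default ?mul0r.
transitivity (\sum_(s : St) (\sum_i c0 0 i * (L i s)%:R) * (R b s)%:R).
  rewrite (eq_bigr (fun i : 'I__ => \sum_s c0 0 i * (L i s)%:R * (R b s)%:R)).
    by rewrite exchange_big; apply: eq_bigr => s _; rewrite mulr_suml.
  move=> j _; rewrite pE addnC fLR natr_sum mulr_sumr; apply: eq_bigr => s _.
  by rewrite natrM mulrA.
apply: big1 => s _; have /rowP/(_ (enum_rank s)) := cA.
rewrite !mxE => cs; rewrite [X in X * _](_ : _ = 0) ?mul0r // -[RHS]cs.
by apply: eq_bigr => j _; rewrite !mxE enum_rankK.
Qed.
End Recurrence.

(** * Counting objects that can be cut and glued *)

(** X a b contains the objects of left size a and right size b, V selects the
    admissible ones, st is the interface at the cut, and the keys l and rho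
    describe the left and the right side. *)
Section Gluing.
Variables (A B : Type) (St : finType) (K1 K2 : eqType).
Variables (X : A -> B -> finType) (V : forall a b, pred (X a b)).
Variables (st : forall a b, X a b -> St).
Variables (l : forall a b, X a b -> K1) (rho : forall a b, X a b -> K2).

Hypothesis keys_inj : forall a b (x y : X a b),
  V x -> V y -> l x = l y -> rho x = rho y -> x = y.
Hypothesis glueable : forall a1 b1 a2 b2 (x : X a1 b1) (y : X a2 b2),
  V x -> V y -> st x = st y ->
  exists z : X a1 b2, [/\ V z, st z = st x, l z = l x & rho z = rho y].

Let Vs a b s := [pred x : X a b | V x && (st x == s)].
Let lefts a b s := undup [seq l x | x : X a b in Vs a b s].
Let rights a b s := undup [seq rho x | x : X a b in Vs a b s].

Let leftsP a b s k :
  reflect (exists2 x : X a b, V x && (st x == s) & k = l x) (k \in lefts a b s).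
Proof. by rewrite mem_undup; apply: (iffP imageP) => -[x]; exists x. Qed.

Let rightsP a b s k :
  reflect (exists2 x : X a b, V x && (st x == s) & k = rho x)
    (k \in rights a b s).
Proof. by rewrite mem_undup; apply: (iffP imageP) => -[x]; exists x. Qed.

Let card_Vs a b s : #|Vs a b s| = size (lefts a b s) * size (rights a b s).
Proof.
rewrite -(size_allpairs pair) cardE -(size_map (fun x => (l x, rho x))).
apply/perm_size/uniq_perm.
- rewrite map_inj_in_uniq ?enum_uniq // => x y.
  by rewrite !mem_enum => /andP[Vx _] /andP[Vy _] [] /keys_inj; apply.
- by apply: allpairs_uniq; rewrite ?undup_uniq // => -[? ?] [? ?].
case=> k1 k2; apply/mapP/allpairsP => [[x]|[[k1' k2']] /=].
  rewrite mem_enum => xV [-> ->]; exists (l x, rho x); split=> //.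
    by apply/leftsP; exists x.
  by apply/rightsP; exists x.
case=> /leftsP[x /andP[Vx /eqP xs] ->] /rightsP[y /andP[Vy /eqP ys] ->] [-> ->].
have [|z [Vz zs <- <-]] := glueable Vx Vy; first by rewrite xs.
by exists z; rewrite // mem_enum inE Vz zs xs /=.
Qed.

Let nonempty a b s := exists x : X a b, V x && (st x == s).

Let nonempty_glue a b a' b' s :
  nonempty a b' s -> nonempty a' b s -> nonempty a b s.
Proof.
move=> [x /andP[Vx /eqP xs]] [y /andP[Vy /eqP ys]].
have [|z [Vz zs _ _]] := glueable Vx Vy; first by rewrite xs.
by exists z; rewrite Vz zs xs /=.
Qed.

Let size_lefts a b b' s :
  nonempty a b s -> nonempty a b' s -> size (lefts a b s) = size (lefts a b' s).
Proof.
have sub b1 b2 : nonempty a b2 s -> {subset lefts a b1 s <= lefts a b2 s}.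
  move=> [y /andP[Vy /eqP ys]] k /leftsP[x /andP[Vx /eqP xs] ->].
  have [|z [Vz zs <- _]] := glueable Vx Vy; first by rewrite xs.
  by apply/leftsP; exists z; rewrite // Vz zs xs /=.
move=> ne ne'; apply/perm_size/uniq_perm; rewrite ?undup_uniq // => k.
by apply/idP/idP; apply: sub.
Qed.

Let size_rights a a' b s :
  nonempty a b s -> nonempty a' b s ->
  size (rights a b s) = size (rights a' b s).
Proof.
have sub a1 a2 : nonempty a2 b s -> {subset rights a1 b s <= rights a2 b s}.
  move=> [x /andP[Vx /eqP xs]] k /rightsP[y /andP[Vy /eqP ys] ->].
  have [|z [Vz zs _ <-]] := glueable Vx Vy; first by rewrite xs.
  by apply/rightsP; exists z; rewrite // Vz zs xs /=.
move=> ne ne'; apply/perm_size/uniq_perm; rewrite ?undup_uniq // => k.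
by apply/idP/idP; apply: sub.
Qed.

(** By gluing, the left keys that occur with a given interface s do not depend
    on the right size, as soon as some admissible object of that right size
    has interface s; symmetrically for right keys. *)
Lemma gluing_factorization :
  exists (L : A -> St -> nat) (R : B -> St -> nat),
    forall a b, #|@V a b| = \sum_s L a s * R b s.
Proof.
(* L a s is the number of left keys for an arbitrary right size for which     *)
(* there are any; R is defined alike. When both are nonzero, gluing provides  *)
(* an object of sizes a and b.                                                *)
pose L a s := if pselect (exists b, nonempty a b s) is left h
  then size (lefts a (projT1 (cid h)) s) else 0.
pose R b s := if pselect (exists a, nonempty a b s) is left h
  then size (rights (projT1 (cid h)) b s) else 0.
exists L, R => a b.
rewrite -sum1_card (partition_big (@st a b) xpredT) //=; apply: eq_bigr => s _.
rewrite sum1_card -[LHS]/#|Vs a b s| /L /R.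
case: pselect => [hb|nb]; last first.
  rewrite mul0n; apply: eq_card0 => x; apply/negP => xV.
  by apply: nb; exists b, x.
case: pselect => [ha|na]; last first.
  rewrite muln0; apply: eq_card0 => x; apply/negP => xV.
  by apply: na; exists a, x.
case: (cid hb) => b' /= nb; case: (cid ha) => a' /= na.
have nab := nonempty_glue nb na.
by rewrite card_Vs (size_lefts nab nb) (size_rights nab na).
Qed.
End Gluing.

(** * Gluing two bijections along a cut *)

Definition inverse_on lo hi (f g : nat -> nat) :=
  forall v, lo <= v < hi -> lo <= f v < hi /\ g (f v) = v.

Definition bij_on lo hi f g := inverse_on lo hi f g /\ inverse_on lo hi g f.

(** The cut lies just before the vertex N, and b vertices follow it. For the
    arcs v -> f v of one type, each going from its left to its right endpoint,
    g is the inverse of f; the arcs that cross the cut are listed by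
    increasing right endpoint. *)
Definition rights N b (g : nat -> nat) := [seq v <- iota N b | g v < N].
Definition lefts N b (g : nat -> nat) := map g (rights N b g).

(** Inside each side the map is inherited. A half-arc that leaves the left side
    with rank p among the crossing arcs is connected to the half-arc of rank p
    of the right side, and conversely. The formula is symmetric under
    exchanging f and g, so that the inverse of a glued map is again a glued
    map. *)
Definition glue N b1 b2 (f1 g1 f2 g2 : nat -> nat) v :=
  if v < N then
    if f1 v < N then f1 v
    else nth 0 (rights N b2 g2) (index v (lefts N b1 g1))
  else
    if N <= f2 v then f2 v
    else nth 0 (lefts N b1 f1) (index v (rights N b2 f2)).

Lemma bij_onC lo hi f g : bij_on lo hi f g -> bij_on lo hi g f.
Proof. by case. Qed.

Lemma mem_rights N b g v : (v \in rights N b g) = (N <= v < N + b) && (g v < N).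
Proof. by rewrite mem_filter mem_iota andbC. Qed.

Lemma rights_uniq N b g : uniq (rights N b g).
Proof. exact/filter_uniq/iota_uniq. Qed.

Lemma sorted_rights N b g : sorted ltn (rights N b g).
Proof. exact/(sorted_filter ltn_trans)/iota_ltn_sorted. Qed.

Lemma nth_rights N b g p : p < size (rights N b g) ->
  N <= nth 0 (rights N b g) p < N + b /\ g (nth 0 (rights N b g) p) < N.
Proof. by move/(mem_nth 0); rewrite mem_rights => /andP[]. Qed.

Lemma nth_lefts N b g p : p < size (rights N b g) ->
  nth 0 (lefts N b g) p = g (nth 0 (rights N b g) p).
Proof. exact: nth_map. Qed.

Lemma nth_rights_ltn N b g p q :
  p < size (rights N b g) -> q < size (rights N b g) ->
  (nth 0 (rights N b g) p < nth 0 (rights N b g) q) = (p < q).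
Proof.
move=> ps qs; apply/idP/idP; last first.
  move=> pq; apply: (sorted_ltn_nth ltn_trans 0 (sorted_rights N b g)) => //.
apply: contraLR; rewrite -!leqNgt leq_eqVlt => /predU1P[->|qp] //.
by apply/ltnW/(sorted_ltn_nth ltn_trans 0 (sorted_rights N b g)).
Qed.

Lemma eq_rights N b g g' :
  (forall v, N <= v < N + b -> (g v < N) = (g' v < N)) ->
  rights N b g = rights N b g'.
Proof. by move=> gg'; apply: eq_in_filter => v; rewrite mem_iota => /gg'. Qed.

Lemma eq_lefts N b g g' :
  (forall v, N <= v < N + b -> g v = g' v) -> lefts N b g = lefts N b g'.
Proof.
move=> gg'; rewrite /lefts (@eq_rights _ _ g g') => [|v /gg' -> //].
by apply/eq_in_map => v; rewrite mem_rights => /andP[/gg'].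
Qed.

Section Crossing.
Variables (lo N b : nat) (f g : nat -> nat).
Hypotheses (loN : lo <= N) (fg : bij_on lo (N + b) f g).

Lemma lefts_inj : {in rights N b g &, injective g}.
Proof.
have gK w : w \in rights N b g -> f (g w) = w.
  rewrite mem_rights => /andP[/andP[Nw wb] _].
  by apply: (fg.2 w _).2; rewrite wb (leq_trans loN).
by move=> x y /gK {2}<- /gK {2}<- ->.
Qed.

Lemma lefts_uniq : uniq (lefts N b g).
Proof. by rewrite map_inj_in_uniq ?rights_uniq //; apply: lefts_inj. Qed.

Lemma crossing_index v : lo <= v < N -> N <= f v ->
  exists p, [/\ p < size (rights N b g), v = nth 0 (lefts N b g) p,
                f v = nth 0 (rights N b g) p & p = index v (lefts N b g)].
Proof.
case: fg => fK gK /andP[lov vN] Nfv.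
have [/andP[lofv fvb] gf] : lo <= f v < N + b /\ g (f v) = v.
  by apply: fK; rewrite lov (leq_trans vN) // leq_addr.
have vr : f v \in rights N b g by rewrite mem_rights Nfv fvb gf vN.
have vl : v \in lefts N b g by rewrite -gf map_f.
exists (index v (lefts N b g)); split=> //.
- by rewrite -(size_map g) index_mem.
- by rewrite nth_index.
- by rewrite -{2}gf (nth_index_map 0 lefts_inj).
Qed.

(** A map is determined by its two sides and by the order of the crossing
    arcs. *)
Lemma self_glue v : lo <= v < N + b -> glue N b b f g f g v = f v.
Proof.
move=> /andP[lov vb]; rewrite /glue; case: ltnP => vN; case: ltnP => fvN //.
  by have [|p [? ? -> <-]] := crossing_index _ fvN; rewrite ?lov.
have vr : v \in rights N b f by rewrite mem_rights vN vb.
by rewrite nth_lefts ?index_mem // nth_index.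
Qed.
End Crossing.

Section Glue.
Variables (N lo1 b1 b2 lo2 : nat) (f1 g1 f2 g2 : nat -> nat).
Hypotheses (lo1N : lo1 <= N) (lo2N : lo2 <= N).
Hypotheses (fg1 : bij_on lo1 (N + b1) f1 g1) (fg2 : bij_on lo2 (N + b2) f2 g2).
Hypothesis size_up : size (rights N b1 g1) = size (rights N b2 g2).
Hypothesis size_low : size (rights N b1 f1) = size (rights N b2 f2).

Let h := glue N b1 b2 f1 g1 f2 g2.
Let h' := glue N b1 b2 g1 f1 g2 f2.

Lemma glue_left_in v : v < N -> f1 v < N -> h v = f1 v.
Proof. by rewrite /h /glue => -> ->. Qed.

Lemma glue_right_in v : N <= v -> N <= f2 v -> h v = f2 v.
Proof. by rewrite /h /glue ltnNge => -> ->. Qed.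

Lemma glue_left_out v : lo1 <= v < N -> N <= f1 v ->
  exists p, [/\ p < size (rights N b1 g1), v = nth 0 (lefts N b1 g1) p,
                f1 v = nth 0 (rights N b1 g1) p
              & h v = nth 0 (rights N b2 g2) p].
Proof.
move=> lvN Nfv; have [p [ps vp fp pE]] := crossing_index lo1N fg1 lvN Nfv.
exists p; split=> //; case/andP: lvN => _ vN.
by rewrite /h /glue vN ltnNge Nfv -pE.
Qed.

Lemma glue_right_out v : N <= v < N + b2 -> f2 v < N ->
  exists p, [/\ p < size (rights N b2 f2), v = nth 0 (rights N b2 f2) p
              & h v = nth 0 (lefts N b1 f1) p].
Proof.
move=> Nvb fvN; have vr : v \in rights N b2 f2 by rewrite mem_rights Nvb.
exists (index v (rights N b2 f2)); rewrite index_mem nth_index //; split=> //.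
by case/andP: Nvb => Nv _; rewrite /h /glue ltnNge Nv /= leqNgt fvN.
Qed.

Lemma glue_left_ltn v : lo1 <= v < N -> (h v < N) = (f1 v < N).
Proof.
move=> lvN; have /andP[_ vN] := lvN.
case: (ltnP (f1 v) N) => fvN; first by rewrite glue_left_in.
have [p [ps _ _ ->]] := glue_left_out lvN fvN.
rewrite size_up in ps; have [/andP[Np _] _] := nth_rights ps.
by rewrite ltnNge Np.
Qed.

Lemma glue_right_ltn v : N <= v < N + b2 -> (h v < N) = (f2 v < N).
Proof.
move=> Nvb; have /andP[Nv _] := Nvb.
case: (ltnP (f2 v) N) => fvN; last by rewrite glue_right_in // ltnNge fvN.
have [p [ps _ ->]] := glue_right_out Nvb fvN.
by rewrite -size_low in ps; rewrite nth_lefts //; have [] := nth_rights ps.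
Qed.

Lemma rights_glue : rights N b2 h = rights N b2 f2.
Proof. exact/eq_rights/glue_right_ltn. Qed.

Lemma lefts_glue : lefts N b2 h = lefts N b1 f1.
Proof.
have sz : size (lefts N b2 h) = size (lefts N b1 f1).
  by rewrite !size_map rights_glue.
apply: (eq_from_nth (x0 := 0)) => // p; rewrite size_map => ps.
rewrite nth_lefts // rights_glue; rewrite rights_glue in ps.
have [Nvb fN] := nth_rights ps.
have [q [qs vq ->]] := glue_right_out Nvb fN.
congr nth; apply/eqP.
by rewrite -(nth_uniq 0 _ _ (rights_uniq N b2 f2)) // -vq.
Qed.

Lemma glue_inverse : inverse_on lo1 (N + b2) h h'.
Proof.
move=> v /andP[lov vb]; case: (ltnP v N) => vN.
  have [/andP[lof fb] gf] : lo1 <= f1 v < N + b1 /\ g1 (f1 v) = v.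
    by apply: fg1.1; rewrite lov (leq_trans vN) // leq_addr.
  case: (ltnP (f1 v) N) => fN.
    rewrite glue_left_in // lof (leq_trans fN) ?leq_addr //; split=> //.
    by rewrite /h' /glue fN gf vN.
  have [|p [ps vp fp ->]] := glue_left_out _ fN; first by rewrite lov.
  rewrite size_up in ps; have [/andP[Np pb] gN] := nth_rights ps.
  rewrite pb (leq_trans lo1N) //; split=> //.
  rewrite /h' /glue ltnNge Np /= leqNgt gN /=.
  by rewrite index_uniq ?rights_uniq.
have [/andP[lof fb] gf] : lo2 <= f2 v < N + b2 /\ g2 (f2 v) = v.
  by apply: fg2.1; rewrite vb (leq_trans lo2N).
case: (ltnP (f2 v) N) => fN; last first.
  rewrite glue_right_in // fb (leq_trans lo1N) //; split=> //.
  by rewrite /h' /glue gf ltnNge fN /= vN.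
have [|p [ps vp ->]] := glue_right_out _ fN; first by rewrite vN.
rewrite -size_low in ps; have [/andP[Np pb] gN] := nth_rights ps.
set w := nth 0 (rights N b1 f1) p in Np pb gN *.
have [/andP[lop _] gfp] : lo1 <= f1 w < N + b1 /\ g1 (f1 w) = w.
  by apply: fg1.1; rewrite pb (leq_trans lo1N).
rewrite nth_lefts // lop (leq_trans gN) ?leq_addr //; split=> //.
rewrite /h' /glue gN gfp ltnNge Np /= -nth_lefts // index_uniq ?size_map //.
apply: lefts_uniq lo1N _; exact: bij_onC fg1.
Qed.

(** For lower arcs the colour is carried by the right endpoint f1 v, which
    gluing replaces by the right endpoint of the same rank on the other side;
    equality of the colours of the crossing arcs makes this harmless. *)
Lemma glue_right_colours (T : Type) (D1 D2 : nat -> T) v :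
    map (D1 \o f1) (lefts N b1 g1) = map (D2 \o f2) (lefts N b2 g2) ->
    lo1 <= v < N ->
  (if h v < N then D1 (h v) else D2 (h v)) = D1 (f1 v).
Proof.
move=> eqD lvN; have /andP[_ vN] := lvN; rewrite glue_left_ltn //.
case: ltnP => fN; first by rewrite glue_left_in.
have [p [ps vp fp ->]] := glue_left_out lvN fN.
have ps2 : p < size (rights N b2 g2) by rewrite -size_up.
have [/andP[Np pb] _] := nth_rights ps2.
have [_ fg] : lo2 <= g2 (nth 0 (rights N b2 g2) p) < N + b2
    /\ f2 (g2 (nth 0 (rights N b2 g2) p)) = nth 0 (rights N b2 g2) p.
  by apply: fg2.2; rewrite pb (leq_trans lo2N).
have := congr1 (fun s => nth (D1 0) s p) eqD.
by rewrite !(nth_map 0) ?size_map //= fg -nth_lefts // -vp.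
Qed.
End Glue.

Lemma glue_bij N lo1 b1 b2 lo2 f1 g1 f2 g2 :
    lo1 <= N -> lo2 <= N ->
    bij_on lo1 (N + b1) f1 g1 -> bij_on lo2 (N + b2) f2 g2 ->
    size (rights N b1 g1) = size (rights N b2 g2) ->
    size (rights N b1 f1) = size (rights N b2 f2) ->
  bij_on lo1 (N + b2) (glue N b1 b2 f1 g1 f2 g2) (glue N b1 b2 g1 f1 g2 f2).
Proof.
move=> l1 l2 fg1 fg2 su sl.
split; first exact: glue_inverse l1 l2 fg1 fg2 su sl.
by apply: glue_inverse l1 l2 _ _ sl su; apply: bij_onC.
Qed.

(** * Crossings and nestings across a cut *)

(** The arcs of one type, seen from their left endpoints: v stands for the arc
    from v to F v, of colour C v. The common form of crossings (rho = ltn) and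
    nestings (rho = gtn) is that all left endpoints precede all right ones;
    this condition also ensures that each v in t is the left endpoint of an
    arc of the relevant type. *)
Definition chain (T : eqType) (e rho : rel nat) lo hi (F : nat -> nat)
    (C : nat -> T) c t :=
  [&& sorted ltn t, sorted rho (map F t), all (fun v => lo <= v < hi) t,
      all (fun v => C v == c) t & all (fun x => all (fun y => e x (F y)) t) t].

Definition chains_below (T : eqType) (e rho : rel nat) lo hi F (C : nat -> T) m :=
  forall c t, chain e rho lo hi F C c t -> size t < m.

Section ErdosSzekeres.
Variables (T0 : eqType) (X : seq T0).

(** x is the last element of an R-sorted sequence of d.+1 elements of X. *)
Definition reach (R : rel T0) d x :=
  `[< exists t, [/\ size t = d, {subset t <= X} & sorted R (rcons t x)] >].

Lemma reachP R d x :
  reflect (exists t, [/\ size t = d, {subset t <= X} & sorted R (rcons t x)])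
    (reach R d x).
Proof. exact: asboolP. Qed.

(** If the two sets were equal, reach R d x would imply reach R d y, hence
    reach R d.+1 x through the step from y to x; starting from d = 0 this
    would build a chain of m elements. *)
Lemma reach_neq (R : rel T0) m x y :
    (forall t, {subset t <= X} -> sorted R t -> size t < m) ->
    x \in X -> y \in X -> R y x ->
  [set d : 'I_m | reach R d y] != [set d : 'I_m | reach R d x].
Proof.
case: m => [|m] short xX yX yx.
  by suff: size (Nil T0) < 0 by []; apply: short.
apply/eqP => /setP eq_yx.
have reach_x d : d <= m -> reach R d x.
  elim: d => [|d IHd] dm; first by apply/reachP; exists [::].
  have /= := eq_yx (Ordinal (ltnW dm : d < m.+1)).
  rewrite !inE IHd ?(ltnW dm) //= => /reachP[t [td tX ty]].
  apply/reachP; exists (rcons t y); split; first by rewrite size_rcons td.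
    by move=> z; rewrite mem_rcons inE => /predU1P[->|/tX].
  case: t ty {td tX} => [|z t] /=; first by rewrite yx.
  by rewrite !rcons_path last_rcons yx andbT.
have /reachP[t [tm tX /short]] := reach_x m (leqnn m).
rewrite size_rcons tm ltnn => tx; suff : false by [].
by apply: tx => z; rewrite mem_rcons inE => /predU1P[->|/tX].
Qed.

(** The colour of x together with the sets of those d < j and d < k for which
    an R1-chain, resp. an R2-chain, of d.+1 elements ends at x is an injective
    labelling. *)
Lemma erdos_szekeres (T : finType) (col : T0 -> T) (R1 R2 : rel T0) j k :
    uniq X ->
    (forall x y, x \in X -> y \in X -> x != y -> col x = col y ->
       [|| R1 x y, R1 y x, R2 x y | R2 y x]) ->
    (forall t, {subset t <= X} -> sorted R1 t -> size t < j) ->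
    (forall t, {subset t <= X} -> sorted R2 t -> size t < k) ->
  size X <= #|{: T * {set 'I_j} * {set 'I_k}}|.
Proof.
move=> Xu tot short1 short2.
pose lab x := (col x, [set d : 'I_j | reach R1 d x],
                      [set d : 'I_k | reach R2 d x]).
rewrite -(size_map lab).
suff /card_uniqP <- : uniq (map lab X) by apply: max_card.
rewrite map_inj_in_uniq // => x y xX yX [cxy r1 r2].
apply: contraTeq isT => xy.
case/or4P: (tot x y xX yX xy cxy) => Rxy.
- by have := reach_neq short1 yX xX Rxy; rewrite r1 eqxx.
- by have := reach_neq short1 xX yX Rxy; rewrite r1 eqxx.
- by have := reach_neq short2 yX xX Rxy; rewrite r2 eqxx.
- by have := reach_neq short2 xX yX Rxy; rewrite r2 eqxx.
Qed.
End ErdosSzekeres.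

Lemma sorted_map_mono (rho : rel nat) (H F : nat -> nat) t :
    rho = ltn \/ rho = gtn ->
    {in t &, forall x y, H x < H y -> F x < F y} ->
  sorted rho (map H t) -> sorted rho (map F t).
Proof.
move=> rhoP mono; rewrite !sorted_map; apply: sub_in_sorted (allss t) => x y xt yt.
by case: rhoP => ->; apply: mono.
Qed.

(** Two arcs of the same colour that cross the cut form a 2-crossing or a
    2-nesting. *)
Lemma crossing_bounded (T : finType) (e : rel nat) lo N b f g (C : nat -> T) j k :
    (forall x y, x < y -> e x y) -> lo <= N -> bij_on lo (N + b) f g ->
    chains_below e ltn lo (N + b) f C j -> chains_below e gtn lo (N + b) f C k ->
  size (rights N b g) <= #|{: T * {set 'I_j} * {set 'I_k}}|.
Proof.
move=> eP loN fg short1 short2.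
have leftsP x : x \in lefts N b g -> lo <= x < N /\ N <= f x.
  case/mapP => w; rewrite mem_rights => /andP[/andP[Nw wb] gN] ->.
  by have [|/andP[-> _] ->] := fg.2 w; rewrite ?gN // wb (leq_trans loN).
pose R (rho : rel nat) x y := [&& x < y, rho (f x) (f y) & C x == C y].
have Rchain rho t : {subset t <= lefts N b g} -> sorted (R rho) t ->
    exists c, chain e rho lo (N + b) f C c t.
  move=> tl tR; exists (C (head 0 t)); apply/and5P; split.
  - by apply: sub_sorted tR => x y /and3P[].
  - by rewrite sorted_map; apply: sub_sorted tR => x y /and3P[].
  - apply/allP => x /tl/leftsP[/andP[-> xN] _].
    by rewrite (leq_trans xN) ?leq_addr.
  - case: t tR {tl} => //= x t tR; rewrite eqxx /=.
    have: path (relpre C eq_op) x t by apply: sub_path tR => ? ? /and3P[].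
    move/order_path_min => /(_ (fun y x z => @eq_op_trans _ _ _ _)).
    by apply: sub_all => y; rewrite eq_sym.
  apply/allP => x /tl/leftsP[/andP[_ xN] _]; apply/allP => y /tl/leftsP[_ Ny].
  exact/eP/(leq_trans xN).
rewrite -(size_map g); apply: (@erdos_szekeres _ _ _ C (R ltn) (R gtn)).
- exact: lefts_uniq loN fg.
- move=> x y /leftsP[/andP[lox xN] _] /leftsP[/andP[loy yN] _] xy Cxy.
  rewrite /R Cxy eqxx /= !andbT.
  have fxy : f x != f y.
    apply: contra_neq xy => fxy.
    by rewrite -[x](fg.1 _ _).2 ?fxy ?(fg.1 _ _).2 //; lia.
  lia.
- by move=> t tl /(Rchain _ _ tl)[c /short1].
- by move=> t tl /(Rchain _ _ tl)[c /short2].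
Qed.

Section GlueChains.
Variables (T : eqType) (e rho : rel nat).
Hypotheses (e_lt : forall x y, x < y -> e x y) (e_le : forall x y, e x y -> x <= y).
Hypothesis rhoP : rho = ltn \/ rho = gtn.
Variables (N lo1 b1 b2 lo2 : nat) (f1 g1 f2 g2 : nat -> nat).
Hypotheses (lo1N : lo1 <= N) (lo2N : lo2 <= N).
Hypotheses (fg1 : bij_on lo1 (N + b1) f1 g1) (fg2 : bij_on lo2 (N + b2) f2 g2).
Hypothesis size_up : size (rights N b1 g1) = size (rights N b2 g2).
Hypothesis size_low : size (rights N b1 f1) = size (rights N b2 f2).
Variables (C1 C2 C : nat -> T).
Hypothesis same_colours : map C1 (lefts N b1 g1) = map C2 (lefts N b2 g2).
Hypothesis same_order : forall p q,
  p < size (rights N b1 g1) -> q < size (rights N b1 g1) ->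
  (nth 0 (lefts N b1 g1) p < nth 0 (lefts N b1 g1) q) =
  (nth 0 (lefts N b2 g2) p < nth 0 (lefts N b2 g2) q).
Let h := glue N b1 b2 f1 g1 f2 g2.
Variable H : nat -> nat.
Hypothesis Hh : forall v, lo1 <= v < N + b2 -> H v = h v.
Hypothesis C_left : forall v, lo1 <= v < N -> C v = C1 v.
Hypothesis C_right : forall v, N <= v < N + b2 -> N <= f2 v -> C v = C2 v.

(** If all elements of a chain t for H are before the cut, t is a chain on the
    first side, because right endpoints beyond the cut are ordered by rank on
    both sides. Otherwise all right endpoints are beyond the cut; psi replaces
    the left endpoints before the cut by those of the same rank on the second
    side, which have the same colours and the same relative order. *)
Lemma glue_chains_below m :
  chains_below e rho lo1 (N + b1) f1 C1 m ->
  chains_below e rho lo2 (N + b2) f2 C2 m ->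
  chains_below e rho lo1 (N + b2) H C m.
Proof.
move=> short1 short2 c t /and5P[t_lt t_rho /allP t_in /allP t_c /allP t_e].
have {}t_rho : sorted rho (map h t).
  by rewrite -(_ : map H t = map h t) //; apply/eq_in_map => v /t_in/Hh.
have {}t_e x y : x \in t -> y \in t -> e x (h y).
  by move=> /t_e/allP e_x yt; rewrite -Hh ?t_in // e_x.
have left_out := glue_left_out b2 f2 g2 lo1N fg1.
have left_in v : v < N -> f1 v < N -> h v = f1 v by exact: glue_left_in.
have left_ltn := glue_left_ltn f2 lo1N fg1 size_up.
have right_ltn := glue_right_ltn g1 g2 size_low.
case: (boolP (all (fun v => v < N) t)) => [/allP tN|].
  have {}t_in v : v \in t -> lo1 <= v < N.
    by move=> vt; have /andP[-> _] := t_in v vt; apply: tN.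
  have f1_ltn x y : x \in t -> y \in t -> h x < h y -> f1 x < f1 y.
    move=> xt yt.
    have xN := t_in x xt; have yN := t_in y yt.
    case: (ltnP (f1 x) N) => fx; case: (ltnP (f1 y) N) => fy.
    - by rewrite [h x]left_in ?[h y]left_in // tN.
    - by move=> _; apply: leq_trans fy.
    - move=> hxy; have := left_ltn x xN; rewrite ltnNge -/h.
      have := left_ltn y yN; rewrite -/h fy; lia.
    have [p [ps _ -> hx]] := left_out x xN fx.
    have [q [qs _ -> hy]] := left_out y yN fy.
    rewrite [h x]hx [h y]hy nth_rights_ltn -?size_up //.
    by rewrite nth_rights_ltn.
  apply: (short1 c t); apply/and5P; split=> //.
  - by apply: sorted_map_mono rhoP _ t_rho => x y; apply: f1_ltn.
  - apply/allP => v /t_in/andP[-> vN] /=; apply: leq_trans vN _.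
    exact: leq_addr.
  - by apply/allP => v vt; rewrite -C_left ?t_in // t_c.
  apply/allP => x xt; apply/allP => y yt; have := t_e x y xt yt.
  case: (ltnP (f1 y) N) => fy; first by rewrite left_in // tN.
  by move=> _; apply/e_lt/(leq_trans _ fy)/tN.
case/allPn => z zt; rewrite -leqNgt => Nz.
have Nh y : y \in t -> N <= h y.
  by move=> /(t_e z _ zt)/e_le; apply: leq_trans.
pose psi x := if x < N then g2 (h x) else x.
have left_t x : x \in t -> x < N -> exists p, [/\ p < size (rights N b1 g1),
    x = nth 0 (lefts N b1 g1) p & psi x = nth 0 (lefts N b2 g2) p].
  move=> xt xN; have lxN : lo1 <= x < N by have /andP[-> _] := t_in x xt.
  have [|p [ps xp _ hx]] := left_out x lxN _.
    by rewrite leqNgt -left_ltn // -leqNgt Nh.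
  exists p; split=> //; rewrite /psi xN [h x]hx nth_lefts //.
  by rewrite -size_up.
have psiN x : x \in t -> (psi x < N) = (x < N).
  move=> xt; rewrite {1}/psi; case: (ltnP x N) => xN.
    have [p [ps _]] := left_t x xt xN; rewrite /psi xN => ->.
    by rewrite nth_lefts -?size_up //; apply: (nth_rights _).2; rewrite -size_up.
  by rewrite ltnNge xN.
have psi_ge x : x \in t -> N <= x -> [/\ N <= x < N + b2, psi x = x & f2 x = h x].
  move=> xt Nx; have /andP[_ xb] := t_in x xt.
  have xr : N <= x < N + b2 by rewrite Nx.
  split=> //; first by rewrite /psi ltnNge Nx.
  by rewrite /h glue_right_in // leqNgt -right_ltn // -leqNgt Nh.
have psiP x : x \in t ->
    [/\ lo2 <= psi x < N + b2, f2 (psi x) = h x & C2 (psi x) = c].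
  move=> xt; case: (ltnP x N) => xN.
    have lxN : lo1 <= x < N by have /andP[-> _] := t_in x xt.
    have [p [ps xp psix]] := left_t x xt xN.
    have hb : lo2 <= h x < N + b2.
      have [|/andP[_ ->]] := (glue_bij lo1N lo2N fg1 fg2 size_up size_low).1 x.
        exact: t_in.
      by rewrite (leq_trans lo2N) ?Nh.
    have [] := fg2.2 _ hb; rewrite {1 2 3}/psi xN => -> ->; split=> //.
    rewrite -(eqP (t_c x xt)) C_left // psix [in RHS]xp.
    by rewrite -!(nth_map 0 c) ?size_map -?size_up // same_colours.
  have [/andP[_ xb] -> ->] := psi_ge x xt xN; split=> //.
    by rewrite xb (leq_trans lo2N).
  rewrite -C_right ?xN ?xb //; first exact/eqP/t_c.
  by have [_ _ ->] := psi_ge x xt xN; apply: Nh.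
have psi_ltn x y : x \in t -> y \in t -> x < y -> psi x < psi y.
  move=> xt yt xy; case: (ltnP y N) => yN.
    have [p [ps xp ->]] := left_t x xt (ltn_trans xy yN).
    have [q [qs yq ->]] := left_t y yt yN.
    by rewrite -same_order // -xp -yq.
  have [_ -> _] := psi_ge y yt yN; case: (ltnP x N) => xN.
    by apply: leq_trans yN; rewrite psiN.
  by have [_ -> _] := psi_ge x xt xN.
rewrite -(size_map psi); apply: (short2 c); apply/and5P; split.
- by apply: (@sorted_map_mono _ id psi t (or_introl erefl) psi_ltn); rewrite map_id.
- rewrite -map_comp (_ : map _ t = map h t) //.
  by apply/eq_in_map => x /psiP[].
- by apply/allP => _ /mapP[x /psiP[xb _ _] ->].
- by apply/allP => _ /mapP[x /psiP[_ _ xc] ->]; rewrite xc.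
apply/allP => _ /mapP[x xt ->]; apply/allP => _ /mapP[y yt ->].
have [_ -> _] := psiP y yt; case: (ltnP x N) => xN.
  by apply/e_lt/(leq_trans _ (Nh y yt)); rewrite psiN.
by have [_ -> _] := psi_ge x xt xN; apply: t_e.
Qed.
End GlueChains.

(** * Coloured permutations as pairs of bijections *)

Lemma path_ltn_le_last x s y : path ltn x s -> y \in x :: s -> y <= last x s.
Proof.
elim: s x y => [|z s IHs] x y /=; first by rewrite inE => _ /eqP->.
move=> /andP[xz pzs]; rewrite inE => /predU1P[->|]; last exact: IHs.
by apply: leq_trans (ltnW xz) (IHs z z pzs (mem_head _ _)).
Qed.

Lemma path_ltn_head_le x s y : path ltn x s -> y \in x :: s -> x <= y.
Proof.
move=> /(order_path_min ltn_trans)/allP min; rewrite inE.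
by move=> /predU1P[->|/min/ltnW].
Qed.

Lemma path_gtn_last_le x s y : path gtn x s -> y \in x :: s -> last x s <= y.
Proof.
elim: s x y => [|z s IHs] x y /=; first by rewrite inE => _ /eqP->.
move=> /andP[zx pzs]; rewrite inE => /predU1P[->|]; last exact: IHs.
by apply: leq_trans (IHs z z pzs (mem_head _ _)) (ltnW zx).
Qed.

(** Both chain conditions compare only the largest left endpoint with the
    smallest right endpoint, which by monotonicity amounts to comparing all
    pairs. *)
Section Chains.
Variables (n : nat) (e : rel nat).
Hypothesis e_mono : forall x y x' y', e x y -> x' <= x -> y <= y' -> e x' y'.

Definition all_pairs (t : seq (Defs.arc n)) :=
  all (fun a => all (fun b => e (left_end a) (right_end b)) t) t.

Let pairsP (t : seq (Defs.arc n)) :=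
  forall a b, a \in t -> b \in t -> e (left_end a) (right_end b).
Let all_pairsP t : reflect (pairsP t) (all_pairs t).
Proof.
apply: (iffP allP) => [h a b /h/allP|h a at_]; first exact.
by apply/allP => b; apply: h.
Qed.

Lemma crossing_chainE t : crossing_chain e t =
  [&& sorted ltn (map (@left_end n) t), sorted ltn (map (@right_end n) t)
    & all_pairs t].
Proof.
case: t => [|a t] //; rewrite /crossing_chain [sorted _ _]/=.
rewrite [sorted _ (map (@right_end n) _)]/=.
apply/and3P/and3P => [[pl ea pr]|[pl pr /all_pairsP ea]]; split=> //.
  apply/all_pairsP => x y xt yt; apply: e_mono ea _ _.
    by apply: path_ltn_le_last pl _; rewrite -map_cons map_f.
  by apply: path_ltn_head_le pr _; rewrite -map_cons map_f.
by rewrite last_map; apply: ea; rewrite ?mem_head ?mem_last.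
Qed.

Lemma nesting_chainE t : nesting_chain e t =
  [&& sorted ltn (map (@left_end n) t), sorted gtn (map (@right_end n) t)
    & all_pairs t].
Proof.
case: t => [|a t] //; rewrite /nesting_chain [sorted _ _]/=.
rewrite [sorted _ (map (@right_end n) _)]/=.
apply/and3P/and3P => [[pl ea pr]|[pl pr /all_pairsP ea]]; split=> //.
  apply/all_pairsP => x y xt yt; apply: e_mono ea _ _.
    by apply: path_ltn_le_last pl _; rewrite -map_cons map_f.
  by apply: path_gtn_last_le pr _; rewrite -map_cons map_f.
by rewrite !last_map; apply: ea; apply: mem_last.
Qed.
End Chains.

Definition arc_rel (u : bool) : rel nat := if u then leq else ltn.

Lemma arc_rel_mono u x y x' y' :
  arc_rel u x y -> x' <= x -> y <= y' -> arc_rel u x' y'.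
Proof. by case: u => /= *; lia. Qed.

Lemma arc_rel_lt u x y : x < y -> arc_rel u x y.
Proof. by case: u => //= /ltnW. Qed.

Lemma arc_rel_le u x y : arc_rel u x y -> x <= y.
Proof. by case: u => //= /ltnW. Qed.

(** Permutations and colourings are transported to the interval of naturals
    [lo, lo + n), so that objects of different sizes can share their cut; the
    values outside this interval are defaults. *)
Definition ext lo n (s : 'S_n) v : nat :=
  if insub (v - lo) is Some i then lo + s i else v.

Lemma extE lo n (s : 'S_n) (i : 'I_n) : ext lo s (lo + i) = lo + s i.
Proof. by rewrite /ext addKn valK. Qed.

Lemma in_span lo n v : lo <= v < lo + n -> exists i : 'I_n, v = lo + i.
Proof.
move=> /andP[lov vn]; have vi : v - lo < n by lia.
by exists (Ordinal vi); rewrite /= subnKC.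
Qed.

Lemma span_ord lo n (i : 'I_n) : lo <= lo + i < lo + n.
Proof. by rewrite leq_addr ltn_add2l ltn_ord. Qed.

Lemma ext_bij lo n (s : 'S_n) : bij_on lo (lo + n) (ext lo s) (ext lo s^-1%g).
Proof.
by split=> v /in_span[i ->]; rewrite !extE ?permK ?permKV span_ord.
Qed.

Lemma ext_onto lo n h h' : bij_on lo (lo + n) h h' ->
  exists s : 'S_n, forall v, lo <= v < lo + n ->
    ext lo s v = h v /\ ext lo s^-1%g v = h' v.
Proof.
case=> hK h'K; have hn (i : 'I_n) : h (lo + i) - lo < n.
  by have [/andP[? ?] _] := hK _ (span_ord lo i); lia.
pose s0 i := Ordinal (hn i).
have s0E i : lo + s0 i = h (lo + i).
  by have [/andP[? ?] _] := hK _ (span_ord lo i); rewrite /= subnKC.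
have s0_inj : injective s0.
  move=> i i' /(congr1 (fun k : 'I_n => lo + k)); rewrite !s0E => e.
  apply/val_inj/(@addnI lo) => /=.
  have [_ <-] := hK _ (span_ord lo i); have [_ <-] := hK _ (span_ord lo i').
  by rewrite e.
exists (perm s0_inj) => v vn.
have sE w : lo <= w < lo + n -> ext lo (perm s0_inj) w = h w.
  by case/in_span => i ->; rewrite extE permE s0E.
split; first exact: sE.
have [_ <-] := (ext_bij lo (perm s0_inj)).1 _ (h'K v vn).1.
by rewrite sE ?(h'K v vn).1 // (h'K v vn).2.
Qed.

Section Coloured.
Variables (r : nat) (c0 : 'I_r).

Definition arc_from n (s : 'S_n) i : arc_of s :=
  exist (fun a => a \in Arc s) (arc_at s i) (imset_f _ isT).

(** The arcs of a permutation are indexed by their sources, so a colouring of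
    the arcs is a colouring of the vertices. *)
Definition colour n (S : coloured_perm n r) i := tagged S (arc_from (tag S) i).

Lemma arc_fromP n (s : 'S_n) (a : arc_of s) : exists i, a = arc_from s i.
Proof.
case: a => a aP; case/imsetP: (aP) => i _ ai.
by exists i; apply/val_inj.
Qed.

Lemma coloured_perm_eq n (S S' : coloured_perm n r) :
  tag S =1 tag S' -> colour S =1 colour S' -> S = S'.
Proof.
case: S S' => s c [s' c'] /= /permP ss'; case: _ / ss' c' => c' cc'.
by congr Tagged; apply/ffunP => a; have [i ->] := arc_fromP a; apply: cc'.
Qed.

Definition cext lo n (S : coloured_perm n r) v :=
  if insub (v - lo) is Some i then colour S i else c0.

Lemma cextE lo n (S : coloured_perm n r) (i : 'I_n) :
  cext lo S (lo + i) = colour S i.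
Proof. by rewrite /cext addKn valK. Qed.

Lemma coloured_perm_onto lo n h h' (C : nat -> 'I_r) :
    bij_on lo (lo + n) h h' ->
  exists S : coloured_perm n r, forall v, lo <= v < lo + n ->
    [/\ ext lo (tag S) v = h v, ext lo (tag S)^-1%g v = h' v & cext lo S v = C v].
Proof.
move=> /ext_onto[s sP].
pose c := [ffun a : arc_of s =>
  C (lo + (if is_upper (val a) then (val a).2.1 else (val a).2.2))].
pose S : coloured_perm n r := Tagged (fun s => {ffun arc_of s -> 'I_r}) c.
exists S => v /[dup] /in_span[i ->] /sP[-> ->]; split=> //.
by rewrite cextE /colour /= ffunE /= /arc_at; case: leqP.
Qed.

(** The arcs of type u (upper for true, lower for false) seen from their left
    endpoints: an upper arc goes from v to s v, a lower arc with left endpoint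
    v has right endpoint s^-1 v, which is its source and carries its colour. *)
Definition half_f u lo n (S : coloured_perm n r) :=
  ext lo (if u then tag S else (tag S)^-1%g).

Definition half_c u lo n (S : coloured_perm n r) v :=
  cext lo S (if u then v else half_f false lo S v).

Lemma half_bij u lo n (S : coloured_perm n r) :
  bij_on lo (lo + n) (half_f u lo S) (half_f (~~ u) lo S).
Proof. by case: u; [|apply: bij_onC]; apply: ext_bij. Qed.

Lemma half_arc lo n (S : coloured_perm n r) (a : arc_of (tag S)) :
  let u := is_upper (val a) in
  [/\ half_f u lo S (lo + left_end (val a)) = lo + right_end (val a),
      half_c u lo S (lo + left_end (val a)) = tagged S a
    & lo <= lo + left_end (val a) < lo + n].
Proof.
have [i ->] := arc_fromP a; rewrite span_ord.
have := cextE lo S i; rewrite /colour /half_c /half_f /=.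
have := extE lo (tag S) i; have := extE lo (tag S)^-1%g (tag S i).
rewrite /is_upper /left_end /right_end /= /arc_at permK.
move=> eV e ec; case le_i: (i <= tag S i); rewrite /= ?le_i; split=> //=.
by rewrite eV.
Qed.

Lemma half_arc_exists u lo n (S : coloured_perm n r) v :
    lo <= v < lo + n -> arc_rel u v (half_f u lo S v) ->
  exists a : arc_of (tag S), is_upper (val a) = u /\ lo + left_end (val a) = v.
Proof.
case/in_span => i ->; rewrite /half_f extE; case: u => /= le_i.
  exists (arc_from (tag S) i); rewrite /= /arc_at.
  by rewrite -(leq_add2l lo) le_i.
exists (arc_from (tag S) ((tag S)^-1%g i)); rewrite /= /arc_at permKV.
by rewrite ltn_add2l ltnNge in le_i; rewrite (negPf le_i).
Qed.

(** Passes from tuples of arcs, a type that depends on the permutation, to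
    sequences of vertices, which can be carried from one permutation to
    another. *)
Lemma has_chainP (ch : forall n, rel nat -> seq (Defs.arc n) -> bool) rho lo n
    (S : coloured_perm n r) m :
    (forall u t, ch n (arc_rel u) t =
      [&& sorted ltn (map (@left_end n) t), sorted rho (map (@right_end n) t)
        & all_pairs (arc_rel u) t]) ->
    (forall x y, rho (lo + x) (lo + y) = rho x y) ->
  has_chain (@ch n) S m <->
  exists u c t, size t = m /\
    chain (arc_rel u) rho lo (lo + n) (half_f u lo S) (half_c u lo S) c t.
Proof.
move=> chE rho_lo.
have arc_lo u x y : arc_rel u (lo + x) (lo + y) = arc_rel u x y.
  by case: u; rewrite /= ?leq_add2l ?ltn_add2l.
(* A sequence of arcs of type u is a chain iff its left endpoints form one.   *)
have chainE u c (t : seq (arc_of (tag S))) :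
    all (fun a => is_upper (val a) == u) t ->
    chain (arc_rel u) rho lo (lo + n) (half_f u lo S) (half_c u lo S) c
      [seq lo + left_end (val a) | a <- t] =
    all (fun a => tagged S a == c) t && ch n (arc_rel u) (map val t).
  move=> /allP tu; rewrite chE /chain !sorted_map.
  have tuP a : a \in t ->
      [/\ half_f u lo S (lo + left_end (val a)) = lo + right_end (val a),
      half_c u lo S (lo + left_end (val a)) = tagged S a
    & lo <= lo + left_end (val a) < lo + n].
    by move=> /tu/eqP <-; apply: half_arc.
  have -> : sorted (relpre (fun a : arc_of (tag S) => lo + left_end (val a)) ltn) t =
    sorted (relpre val (relpre (@left_end n) ltn)) t.
    by apply: eq_sorted => a b /=; rewrite ltn_add2l.
  have -> : sorted (relpre (fun a : arc_of (tag S) => lo + left_end (val a))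
       (relpre (half_f u lo S) rho)) t =
    sorted (relpre val (relpre (@right_end n) rho)) t.
    apply: (eq_in_sorted (P := mem t)) (allss t) => a b /tuP[/= -> _ _] /tuP[-> _ _].
    by rewrite rho_lo.
  rewrite !all_map.
  have -> : all (preim (fun a : arc_of (tag S) => lo + left_end (val a))
       (fun v => lo <= v < lo + n)) t by apply/allP => a /tuP[].
  have -> : all (preim (fun a : arc_of (tag S) => lo + left_end (val a))
       (fun v => half_c u lo S v == c)) t = all (fun a => tagged S a == c) t.
    by apply: eq_in_all => a /tuP[_ /= -> _].
  have -> : all (preim (fun a : arc_of (tag S) => lo + left_end (val a))
       (fun x => all (fun y => arc_rel u x (half_f u lo S y))
          [seq lo + left_end (val a) | a <- t])) t =
     all_pairs (arc_rel u) (map val t).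
    rewrite /all_pairs all_map; apply: eq_in_all => a _ /=; rewrite !all_map.
    by apply: eq_in_all => b /tuP[/= -> _ _]; rewrite arc_lo.
  by rewrite /=; do !case: (sorted _ _) => //=; rewrite ?andbF.
split.
  move=> /existsP[t /existsP[c /andP[tc]]] /orP[] /andP[tu cht].
    exists true, c, [seq lo + left_end (val a) | a <- t].
    rewrite size_map size_tuple chainE ?tc //.
    by apply: sub_all tu => a ->.
  exists false, c, [seq lo + left_end (val a) | a <- t].
  rewrite size_map size_tuple chainE ?tc //.
  by apply: sub_all tu => a /negPf->.
case=> u [c [t [tm cht]]].
(* Conversely, every element of a chain is the left endpoint of an arc.       *)
have [t' [t'u tE]] : exists t' : seq (arc_of (tag S)),
    all (fun a => is_upper (val a) == u) t' /\
    t = [seq lo + left_end (val a) | a <- t'].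
  have /and5P[_ _ /allP t_in _ /allP t_e] := cht.
  have {t_e} t_e v : v \in t -> arc_rel u v (half_f u lo S v).
    by move=> vt; have /allP/(_ v vt) := t_e v vt.
  elim: t {tm cht} t_in t_e => [|v t IHt] t_in t_e; first by exists [::].
  have vt := mem_head v t.
  have [a [au av]] := half_arc_exists (t_in v vt) (t_e v vt).
  have [||t' [t'u ->]] := IHt.
  - by move=> w wt; apply: t_in; rewrite inE wt orbT.
  - by move=> w wt; apply: t_e; rewrite inE wt orbT.
  by exists (a :: t'); rewrite /= au av eqxx.
have sz : size t' == m by rewrite -tm tE size_map.
move: cht; rewrite tE chainE // => /andP[tc cht].
apply/existsP; exists (Tuple sz); apply/existsP; exists c; rewrite tc /=.
apply/orP; case: u cht t'u {tE} => cht t'u; [left|right]; rewrite cht andbT.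
  by apply: sub_all t'u => a /eqP.
by apply: sub_all t'u => a /eqP->.
Qed.

(** The inequalities cr S < j and ne S < k, in terms of left endpoints. *)
Definition avoids j k lo n (S : coloured_perm n r) :=
  forall u (below := fun rho => chains_below (arc_rel u) rho lo (lo + n)
      (half_f u lo S) (half_c u lo S)),
    below ltn j /\ below gtn k.

Lemma bigmax_below n (P : pred nat) j : 0 < j -> (forall m, P m -> m <= n) ->
  (\max_(m < n.+1 | P m) m < j <-> forall m, P m -> m < j).
Proof.
case: j => // j _ Pn; rewrite ltnS; split=> [/bigmax_leqP le_j m Pm|le_j].
  by rewrite ltnS; apply: (le_j (Ordinal (Pn m Pm : m < n.+1))).
by apply/bigmax_leqP => m /le_j.
Qed.

Lemma avoidsP j k lo n (S : coloured_perm n r) : 0 < j -> 0 < k ->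
  reflect (avoids j k lo S) ((cr S < j) && (ne S < k)).
Proof.
move=> j0 k0.
have crP := has_chainP (lo := lo) S _ (fun u => crossing_chainE (@arc_rel_mono u))
  (fun x y => ltn_add2l lo x y).
have neP := has_chainP (lo := lo) S _ (fun u => nesting_chainE (@arc_rel_mono u))
  (fun x y => ltn_add2l lo y x).
have crj := bigmax_below j0 (@has_crossing_leq n r S).
have nek := bigmax_below k0 (@has_nesting_leq n r S).
apply: (iffP andP) => [[/crj Sj /nek Sk] u|av].
  by split=> c t tP; [apply/Sj/crP|apply/Sk/neP]; exists u, c, t.
split; [apply/crj => m /crP|apply/nek => m /neP] => -[u [c [t [<-]]]];
  [exact: (av u).1|exact: (av u).2].
Qed.
End Coloured.

(** * The interface at a cut *)

(** The bound on the number of crossing arcs of one type that erdos_szekeres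
    provides. *)
Definition crossing_bound r j k := #|{: 'I_r * {set 'I_j} * {set 'I_k}}|.

Section Interface.
Variables (r : nat) (c0 : 'I_r) (j k : nat).

Let M := crossing_bound r j k.

(** L lists the left endpoints and K the colours of the crossing arcs by
    increasing right endpoint. At most M arcs cross, so onth takes the value
    None at some index, and the pattern determines their number. *)
Definition pattern (L : seq nat) (K : seq 'I_r) :=
  [ffun pq : 'I_M.+1 * 'I_M.+1 => (onth K pq.1, nth 0 L pq.1 < nth 0 L pq.2)].

Lemma pattern_inj L K L' K' :
    size L = size K -> size L' = size K' -> size L <= M -> size L' <= M ->
    pattern L K = pattern L' K' ->
  K = K' /\ forall p q, p < size L -> q < size L ->
    (nth 0 L p < nth 0 L q) = (nth 0 L' p < nth 0 L' q).
Proof.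
move=> sLK sLK' sL sL' /ffunP eq_pat.
have eqpq p q : p <= M -> q <= M ->
    onth K p = onth K' p /\ (nth 0 L p < nth 0 L q) = (nth 0 L' p < nth 0 L' q).
  move=> pM qM; have := eq_pat (Ordinal (pM : p < M.+1), Ordinal (qM : q < M.+1)).
  by rewrite !ffunE => -[].
split=> [|p q pL qL]; last first.
  by apply: (eqpq p q _ _).2; 
    apply: ltnW; [apply: leq_trans pL sL|apply: leq_trans qL sL].
apply: eq_from_onth => p; case: (leqP p M) => pM; first by have [] := eqpq p p pM pM.
by rewrite !onth_default // -?sLK -?sLK' ltnW // (leq_ltn_trans _ pM).
Qed.

Definition crossing_lefts N b u lo n (S : coloured_perm n r) :=
  lefts N b (half_f (~~ u) lo S).
Definition crossing_rights N b u lo n (S : coloured_perm n r) :=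
  rights N b (half_f (~~ u) lo S).

Definition interface N b lo n (S : coloured_perm n r) :=
  [ffun u => pattern (crossing_lefts N b u lo S)
                     (map (half_c c0 u lo S) (crossing_lefts N b u lo S))].

(** Left endpoints of crossing arcs are recorded in the order of their right
    endpoints, but the right endpoints themselves are hidden: minn replaces
    every vertex beyond the cut by N. In right_key, the truncated subtraction
    replaces every vertex before the cut by 0. *)
Definition left_key N b lo n (S : coloured_perm n r) :=
  ([seq (minn (half_f true lo S v) N, cext c0 lo S v) | v <- iota lo (N - lo)],
   crossing_lefts N b true lo S, crossing_lefts N b false lo S).

Definition right_key N b lo n (S : coloured_perm n r) :=
  ([seq ((half_f true lo S v).+1 - N, cext c0 lo S v) | v <- iota N b],
   crossing_rights N b true lo S, crossing_rights N b false lo S).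

(** The interface is truncated at M crossing arcs; this loses nothing when
    long chains are excluded. *)
Lemma interface_eq N b1 b2 lo1 lo2 n1 n2
    (x : coloured_perm n1 r) (y : coloured_perm n2 r) :
    lo1 <= N -> lo2 <= N -> lo1 + n1 = N + b1 -> lo2 + n2 = N + b2 ->
    avoids c0 j k lo1 x -> avoids c0 j k lo2 y ->
    interface N b1 lo1 x = interface N b2 lo2 y ->
  forall u,
  let: L1 := crossing_lefts N b1 u lo1 x in
  let: L2 := crossing_lefts N b2 u lo2 y in
  [/\ size (crossing_rights N b1 u lo1 x) = size (crossing_rights N b2 u lo2 y),
      map (half_c c0 u lo1 x) L1 = map (half_c c0 u lo2 y) L2
    & forall p q, p < size (crossing_rights N b1 u lo1 x) ->
        q < size (crossing_rights N b1 u lo1 x) ->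
      (nth 0 L1 p < nth 0 L1 q) = (nth 0 L2 p < nth 0 L2 q)].
Proof.
move=> lo1N lo2N n1E n2E xv yv /ffunP eq_xy u.
have bound b lo n (z : coloured_perm n r) : lo <= N -> lo + n = N + b ->
    avoids c0 j k lo z -> size (crossing_rights N b u lo z) <= M.
  move=> loN nE /(_ u)[]; rewrite nE; apply: crossing_bounded loN _.
    exact: arc_rel_lt.
  by rewrite -nE; apply: half_bij.
have := eq_xy u; rewrite !ffunE => /pattern_inj[]; rewrite ?size_map ?bound //.
move=> eqK eqL; split=> //.
by have := congr1 size eqK; rewrite !size_map.
Qed.

(** Both keys together contain the data from which self_glue rebuilds the
    permutation. *)
Lemma keys_inj N b lo n (x y : coloured_perm n r) :
    lo <= N -> lo + n = N + b ->
    left_key N b lo x = left_key N b lo y ->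
    right_key N b lo x = right_key N b lo y -> x = y.
Proof.
move=> loN nE [/eq_in_map eqL Lu Ll] [/eq_in_map eqR Ru Rl].
have eqL' v : v < N -> lo <= v ->
    minn (half_f true lo x v) N = minn (half_f true lo y v) N /\
    cext c0 lo x v = cext c0 lo y v.
  move=> vN lov; have /eqL[-> ->] // : v \in iota lo (N - lo).
  by rewrite mem_iota subnKC // lov.
have eqR' v : N <= v -> v < N + b ->
    (half_f true lo x v).+1 - N = (half_f true lo y v).+1 - N /\
    cext c0 lo x v = cext c0 lo y v.
  move=> Nv vb; have /eqR[-> ->] // : v \in iota N b.
  by rewrite mem_iota Nv.
have glueE (z : coloured_perm n r) v : lo <= v < N + b ->
    glue N b b (half_f true lo z) (half_f false lo z)
      (half_f true lo z) (half_f false lo z) v = half_f true lo z v.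
  by apply: self_glue loN _ v; rewrite -nE; apply: half_bij.
have eq_f v : lo <= v < N + b -> half_f true lo x v = half_f true lo y v.
  move=> vN; rewrite -[LHS]glueE // -[RHS]glueE //.
  move: vN => /andP[lov vb].
  rewrite /glue; case: ltnP => vN.
    have [fxy _] := eqL' v vN lov.
    have -> : (half_f true lo x v < N) = (half_f true lo y v < N).
      by lia.
    case: ltnP => fN; first by lia.
    by congr (nth 0 _ (index v _)).
  have [fxy _] := eqR' v vN vb.
  have -> : (N <= half_f true lo x v) = (N <= half_f true lo y v) by lia.
  case: leqP => fN; first by lia.
  by congr (nth 0 _ (index v _)).
have eq_c v : lo <= v < N + b -> cext c0 lo x v = cext c0 lo y v.
  move=> /andP[lov vb]; case: (ltnP v N) => vN.
    by have [] := eqL' v vN lov.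
  by have [] := eqR' v vN vb.
apply: coloured_perm_eq => i; have := span_ord lo i; rewrite nE => iN.
  by have := eq_f _ iN; rewrite /half_f !extE => /addnI/val_inj.
by have := eq_c _ iN; rewrite !cextE.
Qed.

(** z is glued from the left side of x and the right side of y; its upper and
    lower arcs are glued separately, by mutually inverse maps. *)
Lemma glue_exists N b1 b2 lo1 lo2 n1 n2 n
    (x : coloured_perm n1 r) (y : coloured_perm n2 r) :
    lo1 <= N -> lo2 <= N ->
    lo1 + n1 = N + b1 -> lo2 + n2 = N + b2 -> lo1 + n = N + b2 ->
    avoids c0 j k lo1 x -> avoids c0 j k lo2 y ->
    interface N b1 lo1 x = interface N b2 lo2 y ->
  exists z : coloured_perm n r,
    [/\ avoids c0 j k lo1 z, interface N b2 lo1 z = interface N b1 lo1 x,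
        left_key N b2 lo1 z = left_key N b1 lo1 x
      & right_key N b2 lo1 z = right_key N b2 lo2 y].
Proof.
move=> lo1N lo2N n1E n2E nE xv yv /(interface_eq lo1N lo2N n1E n2E xv yv) eq_xy.
have bx u : bij_on lo1 (N + b1) (half_f u lo1 x) (half_f (~~ u) lo1 x).
  by rewrite -n1E; apply: half_bij.
have by_ u : bij_on lo2 (N + b2) (half_f u lo2 y) (half_f (~~ u) lo2 y).
  by rewrite -n2E; apply: half_bij.
have sz u : size (rights N b1 (half_f u lo1 x)) = size (rights N b2 (half_f u lo2 y)).
  by have [+ _ _] := eq_xy (~~ u); rewrite /crossing_rights negbK.
pose h u := glue N b1 b2 (half_f u lo1 x) (half_f (~~ u) lo1 x)
                         (half_f u lo2 y) (half_f (~~ u) lo2 y).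
have h_bij : bij_on lo1 (lo1 + n) (h true) (h false).
  by rewrite nE; apply: glue_bij lo1N lo2N (bx true) (by_ true) _ _; apply: sz.
pose C v := if v < N then cext c0 lo1 x v else cext c0 lo2 y v.
have [z zP] := coloured_perm_onto c0 C h_bij.
have fz u v : lo1 <= v < N + b2 -> half_f u lo1 z v = h u v.
  by rewrite -nE => /zP[? ? _]; case: u.
have cz v : lo1 <= v < N + b2 -> cext c0 lo1 z v = C v.
  by rewrite -nE => /zP[].
have span_left v : lo1 <= v < N -> lo1 <= v < N + b2.
  by move=> /andP[-> vN]; rewrite (leq_trans vN) ?leq_addr.
have span_right v : N <= v < N + b2 -> lo1 <= v < N + b2.
  by move=> /andP[Nv ->]; rewrite (leq_trans lo1N).
have lz u : crossing_lefts N b2 u lo1 z = crossing_lefts N b1 u lo1 x.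
  rewrite /crossing_lefts (@eq_lefts _ _ _ (h (~~ u))) => [|v /span_right/fz //].
  by rewrite /h negbK; apply: lefts_glue; rewrite ?sz.
have rz u : crossing_rights N b2 u lo1 z = crossing_rights N b2 u lo2 y.
  rewrite /crossing_rights (@eq_rights _ _ _ (h (~~ u))) => [|v /span_right/fz -> //].
  by rewrite /h negbK; apply: rights_glue; rewrite ?sz.
(* Gluing preserves the colour of each arc, seen from either side.            *)
have c_left u v : lo1 <= v < N -> half_c c0 u lo1 z v = half_c c0 u lo1 x v.
  move=> vN; have vs := span_left v vN; rewrite /half_c.
  case: u; first by rewrite cz // /C; case/andP: vN => _ ->.
  rewrite fz // cz; last first.
    by have [_ /(_ v)] := h_bij; rewrite nE => /(_ vs)[].
  apply: (glue_right_colours lo1N lo2N (bx false) (by_ false)) => //.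
  by have [_ + _] := eq_xy false.
have c_right u v : N <= v < N + b2 -> N <= half_f u lo2 y v ->
    half_c c0 u lo1 z v = half_c c0 u lo2 y v.
  move=> vN fN; have vs := span_right v vN; rewrite /half_c.
  have /andP[Nv vb] := vN.
  case: u fN => fN; first by rewrite cz // /C ltnNge Nv.
  have [|/andP[_ fb] _] := (by_ false).1 v; first by rewrite vb (leq_trans lo2N).
  rewrite fz // /h /= (glue_right_in _ _ _ _ _ Nv fN) cz ?span_right ?fN //.
  by rewrite /C ltnNge fN.
exists z; split.
- move=> u; have [su su' sl] := eq_xy u.
  have [xj xk] := xv u; have [yj yk] := yv u; rewrite n1E n2E nE in xj xk yj yk *.
  have sz' := sz u; have := glue_chains_below (@arc_rel_lt u) (@arc_rel_le u) _
    lo1N lo2N (bx u) (by_ u) su sz' su' sl (fz u) (c_left u) (c_right u).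
  by move=> gl; split; apply: gl => //; [left|right].
- apply/ffunP => u; rewrite !ffunE lz; congr (pattern _ _).
  apply/eq_in_map => v /mapP[w]; rewrite mem_rights => /andP[/andP[Nw wb] gN] ->.
  apply: c_left; rewrite gN andbT.
  by have [|/andP[]] := (bx (~~ u)).1 w; first by rewrite wb (leq_trans lo1N).
- rewrite /left_key !lz; congr (_, _, _); apply/eq_in_map => v.
  rewrite mem_iota subnKC // => vN; have /andP[lov v_lt] := vN.
  rewrite fz ?span_left // cz ?span_left // /C v_lt; congr pair.
  have := glue_left_ltn (half_f true lo2 y) lo1N (bx true) (sz false) vN.
  case fN: (half_f true lo1 x v < N).
    by move=> _; rewrite /h (glue_left_in _ _ _ _ _ v_lt fN).
  by rewrite /h /=; lia.
rewrite /right_key !rz; congr (_, _, _); apply/eq_in_map => v.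
rewrite mem_iota => vN; have /andP[Nv vb] := vN.
rewrite fz ?span_right // cz ?span_right // /C ltnNge Nv; congr pair.
have := glue_right_ltn (half_f false lo1 x) (half_f false lo2 y) (sz true) vN.
case: (ltnP (half_f true lo2 y v) N) => fN.
  by rewrite /h /=; lia.
by move=> _; rewrite /h (glue_right_in _ _ _ _ _ Nv fN).
Qed.
End Interface.

Theorem mainTheorem3 (j k r : nat) (hj : 0 < j) (hk : 0 < k) (hr : 0 < r) :
  rational_fps (fun n : nat => ((NCN j k n r)%:R)%R).
Proof.
pose c0 : 'I_r := Ordinal hr.
pose M := crossing_bound r j k.
pose St : finType :=
  {ffun bool -> {ffun 'I_M.+1 * 'I_M.+1 -> option 'I_r * bool}}.
(* Any position of the cut that leaves room for a = 0, ..., #|St| vertices    *)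
(* before it would do.                                                        *)
pose N := #|St|; pose lo (a : 'I_N.+1) := N - a.
have loN a : lo a <= N by apply: leq_subr.
have loE (a : 'I_N.+1) b : lo a + (a + b) = N + b.
  by rewrite addnA subnK // -ltnS.
have [||L [R LR]] := @gluing_factorization 'I_N.+1 nat St _ _
  (fun a b => coloured_perm (a + b) r)
  (fun a b S => (cr S < j) && (ne S < k))
  (fun a b => interface c0 j k N b (lo a) (n := a + b))
  (fun a b => left_key c0 N b (lo a) (n := a + b))
  (fun a b => right_key c0 N b (lo a) (n := a + b)).
- by move=> a b x y _ _; apply: keys_inj.
- move=> a1 b1 a2 b2 x y /(avoidsP c0 (lo a1) _ hj hk) xv.
  move=> /(avoidsP c0 (lo a2) _ hj hk) yv eq_xy.
  have [z [zv ? ? ?]] := glue_exists (loN a1) (loN a2) (loE a1 b1) (loE a2 b2)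
    (loE a1 b2) xv yv eq_xy.
  by exists z; split=> //; apply/(avoidsP c0 (lo a1) _ hj hk).
apply: (@rational_fps_of_factorization St (fun n => NCN j k n r) L R) => a b.
by rewrite -LR /NCN cardsE.
Qed.
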